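(* Let $k$ be an odd positive integer and consider the polynomial equation $$\binom{f_1(x)}{k}+\binom{x}{2}=\binom{f_2(x)}{2}$$ in unknown polynomials $f_1,f_2\in\mathbb{Q}[x]$ with $\deg f_1=2$ and $\deg f_2=k$, where two solutions $(f_1(x),f_2(x))$ and $(f_1(1-x),f_2(1-x))$ are counted as one. Then: (1) for $k=3$ and for $k=5$ the equation has exactly three solutions; (2) for $k=7$ the equation has exactly one solution; (3) for $k\in\{9,11,13,15,17,19\}$ the equation has no solutions.
   Context: For a polynomial $f\in\mathbb{Q}[x]$ and a positive integer $k$, $\binom{f}{k}$ denotes the polynomial $\frac{f(f-1)\cdots(f-k+1)}{k!}\in\mathbb{Q}[x]$; in particular $\binom{x}{2}=\frac{x(x-1)}{2}$. Note that $\binom{x}{2}=\binom{1-x}{2}$, so if $(f_1(x),f_2(x))$ is a solution then so is $(f_1(1-x),f_2(1-x))$; such pairs are identified when counting. *)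

(* Defs.v *)
From mathcomp Require Import all_boot all_order all_algebra.

Set Implicit Arguments.
Unset Strict Implicit.
Unset Printing Implicit Defensive.

Import GRing.Theory.
Local Open Scope ring_scope.

Definition binp (f : {poly rat}) (k : nat) : {poly rat} :=
  (k`!%:R)^-1 *: \prod_(i < k) (f - i%:R%:P).

Definition is_solution (k : nat) (s : {poly rat} * {poly rat}) : Prop :=
  [/\ size s.1 = 3%N, size s.2 = k.+1
    & binp s.1 k + binp 'X 2 = binp s.2 2].

Definition reflect_pair (s : {poly rat} * {poly rat}) :
    {poly rat} * {poly rat} :=
  (s.1 \Po (1 - 'X), s.2 \Po (1 - 'X)).

(* [reflect_pair] is an involution, so this is an equivalence relation. *)
Definition same_solution (s t : {poly rat} * {poly rat}) : Prop :=
  t = s \/ t = reflect_pair s.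

(* [S] lists one representative of each class of solutions. *)
Definition has_exactly_solutions (k n : nat) : Prop :=
  exists S : seq ({poly rat} * {poly rat}),
    [/\ size S = n,
        forall s, s \in S -> is_solution k s,
        forall i j, (i < size S)%N -> (j < size S)%N ->
          same_solution (nth (0, 0) S i) (nth (0, 0) S j) -> i = j
      & forall s, is_solution k s -> exists2 t, t \in S & same_solution t s].

(* Main.v *)
Require Import Defs.
From Stdlib Require Import ZArith.
From mathcomp Require Import all_boot all_order all_algebra.
From mathcomp Require Import ring zify ssrZ.

(**
  With [Z = 2x - 1] and [g = 2 f_2 - 1] the equation reads
  [g^2 = Z^2 + (8 / k!) f_1 (f_1 - 1) ... (f_1 - k + 1)].  Comparing it with its
  image under the reflection in the axis of the quadratic [f_1] forces that axis
  to be [x = 1/2] and [g] to be odd about it, so [f_1 = a Z^2 + c] and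
  [g = Z q(f_1)] with
  [(y - c) (q(y)^2 - 1) = (8 a / k!) y (y - 1) ... (y - k + 1)].
  Hence [c] is one of [0, ..., k - 1], and [q], of degree [m = (k - 1) / 2], takes
  the values 1 and -1 at the other integers of that range.  The polynomial
  [(y - c) q(y)] of degree [m + 1] thus has known values at [0, ..., k - 1] up to
  signs, and its differences of order [m + 2] vanish, which leaves finitely many
  sign patterns to test.  The surviving ones split the integers other than [c]
  into two sets whose monic polynomials differ by a constant (ideal
  Prouhet-Tarry-Escott solutions), and each split gives back one solution.
*)

Set Implicit Arguments.
Unset Strict Implicit.
Unset Printing Implicit Defensive.

Import GRing.Theory Num.Theory.
Local Open Scope ring_scope.

(** * Falling factorials and completing the square *)

Definition fallp n : {poly rat} := \prod_(i < n) ('X - i%:R%:P).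

Lemma size_fallp n : size (fallp n) = n.+1.
Proof. by rewrite /fallp size_prod_XsubC /index_enum -enumT size_enum_ord. Qed.

Lemma fallp_neq0 n : fallp n != 0.
Proof. by rewrite -size_poly_eq0 size_fallp. Qed.

Lemma root_fallpP n x : reflect (exists2 i, (i < n)%N & x = i%:R) (root (fallp n) x).
Proof.
rewrite /root /fallp horner_prod; apply: (iffP idP) => [|[i lt_in ->]].
  case/prodf_eq0 => i _; rewrite hornerXsubC subr_eq0 => /eqP ->.
  by exists i.
apply/prodf_eq0; exists (Ordinal lt_in) => //.
by rewrite hornerXsubC subrr.
Qed.

Lemma binpE f k : binp f k = (k`!%:R)^-1 *: (fallp k \Po f).
Proof.
rewrite /binp /fallp rmorph_prod /=; congr (_ *: _); apply: eq_bigr => i _.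
by rewrite /= comp_polyB comp_polyX comp_polyC.
Qed.

Lemma comp_poly_sqr (p q : {poly rat}) : p ^+ 2 \Po q = (p \Po q) ^+ 2.
Proof. exact: rmorphXn. Qed.

Lemma comp_poly1 (q : {poly rat}) : 1 \Po q = 1.
Proof. exact: rmorph1. Qed.

Lemma size_sqr (p : {poly rat}) : p != 0 -> size (p ^+ 2) = ((size p).-1 * 2).+1.
Proof. by move=> p0; rewrite -size_exp -polySpred // expf_eq0. Qed.

Definition centredX : {poly rat} := 2%:R *: 'X - 1.

Lemma binp2E (f : {poly rat}) : 8%:R *: binp f 2 = (2%:R *: f - 1) ^+ 2 - 1.
Proof.
rewrite /binp 2!big_ord_recl big_ord0 scalerA /=.
rewrite (_ : 8%:R * _ = 4%:R) //.
rewrite -!mul_polyC !rmorph_nat -[bump 0 0]/1%N; ring.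
Qed.

(** Multiplying by 8 completes the square in both binomials of order 2; the two constants -1
    cancel. *)
Lemma binp_eqE (f g : {poly rat}) k :
  binp f k + binp 'X 2 = binp g 2 <->
  (2%:R *: g - 1) ^+ 2 = centredX ^+ 2 + (8%:R / k`!%:R) *: (fallp k \Po f).
Proof.
have -> : (8%:R / k`!%:R) *: (fallp k \Po f) = 8%:R *: binp f k.
  by rewrite binpE scalerA.
have n8 : 8%:R != 0 :> rat by [].
split=> [E|E].
  have := congr1 (fun p => 8%:R *: p) E; rewrite scalerDr !binp2E -/centredX => E'.
  by rewrite -[LHS](subrK 1) -E'; ring.
apply: (scalerI n8); rewrite scalerDr !binp2E -/centredX E; ring.
Qed.

Lemma size_centredX : size centredX = 2%N.
Proof.
rewrite /centredX size_polyDl ?size_scale ?size_polyX //.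
by rewrite size_polyN size_poly1.
Qed.

(** * Solutions built from a Pell-type identity *)

Definition quad (a c : rat) : {poly rat} := a *: centredX ^+ 2 + c%:P.

Lemma size_quad (a c : rat) : a != 0 -> size (quad a c) = 3%N.
Proof.
move=> a0; rewrite /quad size_polyDl size_scale // size_sqr ?size_centredX //;
  try by rewrite -size_poly_eq0 size_centredX.
by rewrite (leq_ltn_trans (size_polyC_leq1 _)).
Qed.

Definition mksol (a c : rat) (q : {poly rat}) : {poly rat} * {poly rat} :=
  (quad a c, 2%:R^-1 *: (centredX * (q \Po quad a c) + 1)).

(** At y = [quad a c] the factor y - c is a Z^2; dividing by [a] then gives the completed-square
    equation for g = Z q(y). *)
Definition pell_eq k (a c : rat) (q : {poly rat}) : Prop :=
  ('X - c%:P) * (q ^+ 2 - 1) = (8%:R * a / k`!%:R) *: fallp k.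

Lemma pell_scal_neq0 k (a : rat) : a != 0 -> 8%:R * a / k`!%:R != 0.
Proof.
move=> a0; rewrite mulf_neq0 ?mulf_neq0 // invr_eq0 pnatr_eq0.
by rewrite -lt0n fact_gt0.
Qed.

(** Compare degrees: 1 + 2 deg q = 2m + 1 for nonconstant [q], while a constant [q] leaves degree at
    most 1 on the left. *)
Lemma pell_size m (l c : rat) (q : {poly rat}) : (0 < m)%N -> l != 0 ->
  ('X - c%:P) * (q ^+ 2 - 1) = l *: fallp m.*2.+1 -> size q = m.+1.
Proof.
move=> m0 l0 E; have q1 : q ^+ 2 - 1 != 0.
  apply/eqP=> q1; move: E; rewrite q1 mulr0 => /esym/eqP.
  by rewrite scaler_eq0 (negPf (fallp_neq0 _)) (negPf l0).
have := congr1 (size \o polyseq) E; rewrite /= size_scale // size_fallp.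
rewrite size_mul ?polyXsubC_eq0 // size_XsubC add2n /= => -[szE].
case: (ltnP 1 (size q)) => szq.
  have : size (q ^+ 2 - 1) = ((size q).-1 * 2).+1.
    have q0 : q != 0 by rewrite -size_poly_gt0; lia.
    rewrite size_polyDl size_sqr // size_polyN size_poly1; lia.
  rewrite szE => -[]; move: szq; case: (size q) => [|n] /= lt1 H; lia.
have : (size (q ^+ 2 - 1)%R <= 1)%N.
  rewrite (leq_trans (size_polyD _ _)) // size_polyN size_poly1 geq_max andbT.
  apply: leq_trans (size_poly_exp_leq _ _) _; lia.
rewrite szE; lia.
Qed.

Lemma mksol_is_solution m (a c : rat) q : (0 < m)%N -> a != 0 ->
  pell_eq m.*2.+1 a c q -> is_solution m.*2.+1 (mksol a c q).
Proof.
move=> m0 a0 E; have szh := size_quad c a0.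
have szq := pell_size m0 (pell_scal_neq0 _ a0) E; split => //=.
- rewrite size_scale //.
  have szQ : size (centredX * (q \Po quad a c)) = m.*2.+2.
    have q0 : q != 0 by rewrite -size_poly_eq0 szq.
    have Q0 : q \Po quad a c != 0 by rewrite comp_poly_eq0 // szh.
    have c0 : centredX != 0 by rewrite -size_poly_eq0 size_centredX.
    rewrite size_mul // size_centredX.
    have := size_comp_poly q (quad a c); rewrite szh szq /= => H.
    rewrite (polySpred Q0) H; lia.
  by rewrite size_polyDl szQ // size_poly1.
- apply/binp_eqE; rewrite scalerA divff // scale1r addrK.
  set Q := q \Po _.
  have := congr1 (comp_poly (quad a c)) E.
  rewrite comp_polyZ comp_polyM !comp_polyB comp_poly_sqr.
  rewrite comp_polyX comp_poly1 !comp_polyC -/Q /quad addrK => E'.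
  apply: (scalerI a0); rewrite scalerDr scalerA.
  have -> : a * (8%:R / (m.*2.+1)`!%:R) = 8%:R * a / (m.*2.+1)`!%:R by ring.
  rewrite -E' -!mul_polyC; ring.
Qed.

(** The reflection sends Z to -Z and fixes Z^2, hence only the odd factor changes sign. *)
Lemma reflect_mksol a c q : reflect_pair (mksol a c q) = mksol a c (- q).
Proof.
have centredXr : centredX \Po (1 - 'X) = - centredX.
  rewrite /centredX comp_polyB comp_polyZ comp_polyX comp_poly1.
  rewrite -!mul_polyC; ring.
have qr : quad a c \Po (1 - 'X) = quad a c.
  by rewrite /quad comp_polyD comp_polyZ comp_polyC comp_poly_sqr centredXr sqrrN.
rewrite /reflect_pair /mksol /= qr comp_polyZ comp_polyD comp_polyM centredXr.
rewrite -comp_polyA qr comp_poly1.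
by rewrite raddfN /= mulrN mulNr.
Qed.

(** * Every solution is symmetric about x = 1/2 *)

Lemma quadratic_vertex_form (f : {poly rat}) : size f = 3%N ->
  exists2 a, a != 0 & exists e c, f = a *: ('X - e%:P) ^+ 2 + c%:P.
Proof.
move=> szf; have a0 : f`_2 != 0.
  by move: (lead_coef_eq0 f); rewrite lead_coefE szf -size_poly_eq0 szf => ->.
exists f`_2 => //; pose b := f`_1 / (2%:R * f`_2).
exists (- b), (f`_0 - f`_2 * b ^+ 2).
have b1 : f`_1 = 2%:R * f`_2 * b by rewrite /b; field.
rewrite -[LHS]coefK poly_def szf 3!big_ord_recl big_ord0 /= b1.
rewrite -!mul_polyC -[bump 0 1]/2%N -[bump 0 0]/1%N.
rewrite !(rmorphM, rmorphB, rmorphN, rmorphXn, rmorph_nat) /=; ring.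
Qed.

Lemma odd_poly_factor (g : {poly rat}) : g \Po (- 'X) = - g ->
  exists p, g = (p \Po 'X^2) * 'X.
Proof.
move=> g_odd; exists (odd_poly g); have gE := poly_even_odd g.
have X2 : 'X^2 \Po - 'X = 'X^2 :> {poly rat}.
  by rewrite comp_poly_sqr comp_polyX sqrrN.
have := congr1 (fun p => p \Po (- 'X)) gE.
rewrite comp_polyD comp_polyM -!comp_polyA X2 comp_polyX g_odd -{3}gE => E.
have : 2%:R *: (even_poly g \Po 'X^2) = 0.
  rewrite scaler_nat mulr2n; set A := _ \Po _ in E *; set B := _ \Po _ in E.
  have -> : A + A = (A + B * - 'X) - (- (A + B * 'X)) by ring.
  by rewrite E subrr.
by move/eqP; rewrite scaler_eq0 /= -{2}gE => /eqP ->; rewrite add0r.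
Qed.

(* With [sg] the reflection in the axis of [f1], [g ^+ 2 - (g \Po sg) ^+ 2] has
   degree at most 1, while its factor [g - (g \Po sg)] has degree [k]: both the
   other factor and the difference vanish. *)
Lemma solution_mksol m s : (0 < m)%N -> is_solution m.*2.+1 s ->
  exists a c q, [/\ a != 0, pell_eq m.*2.+1 a c q & s = mksol a c q].
Proof.
case: s => f1 f2 m0 [/= sz1 sz2 /binp_eqE]; set k := m.*2.+1 in sz2 *.
have n2 : 2%:R != 0 :> rat by [].
set g := 2%:R *: f2 - 1 => gE.
have szg : size g = k.+1.
  have s2 : size (2%:R *: f2) = k.+1 by rewrite size_scale.
  by rewrite /g size_polyDl s2 // size_polyN size_poly1.
have f2E : f2 = 2%:R^-1 *: (g + 1) by rewrite /g subrK scalerA mulVf ?scale1r.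
have [a' a0' [e [c fE]]] := quadratic_vertex_form sz1.
pose sg : {poly rat} := (2%:R * e)%:P - 'X.
have szsg : size sg = 2%N.
  by rewrite /sg -opprB size_polyN size_XsubC.
have f1sg : f1 \Po sg = f1.
  rewrite fE /sg comp_polyD comp_polyZ comp_polyC comp_poly_sqr.
  rewrite comp_polyB comp_polyX comp_polyC.
  by rewrite -!mul_polyC rmorphM rmorph_nat /=; ring.
have Esg := congr1 (fun p => p \Po sg) gE.
rewrite /= comp_polyD comp_polyZ -comp_polyA f1sg !comp_poly_sqr in Esg.
have lin : (g - (g \Po sg)) * (g + (g \Po sg)) =
           (2%:R * e - 1)%:P * (8%:R *: ('X - e%:P)).
  transitivity (g ^+ 2 - (g \Po sg) ^+ 2); first by ring.
  rewrite gE Esg opprD addrACA subrr addr0 /centredX.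
  rewrite comp_polyB comp_polyZ comp_polyX comp_poly1.
  by rewrite -!mul_polyC /sg !(rmorphB, rmorphM, rmorph_nat, rmorph1) /=; ring.
have lsg : lead_coef sg = -1.
  by rewrite /sg -opprB lead_coefN lead_coefXsubC.
have szgs : size (g \Po sg) = k.+1 by rewrite size_comp_poly2.
(* As k is odd, the leading coefficient changes sign, so nothing cancels at degree k in the
   difference. *)
have lg : (g \Po sg)`_k = - g`_k.
  have := @lead_coef_comp _ g sg; rewrite szsg => /(_ isT).
  rewrite lsg !lead_coefE szg szgs => ->.
  by rewrite -signr_odd /k /= odd_double expr1 mulrN1.
have szd : (k < size (g - (g \Po sg))%R)%N.
  rewrite ltnNge; apply/negP => /leq_sizeP/(_ k (leqnn _))/eqP.
  rewrite coefB lg opprK -mulr2n mulrn_eq0 /=.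
  by have := lead_coef_eq0 g; rewrite lead_coefE szg -size_poly_eq0 szg /= => ->.
have gsg0 : g + (g \Po sg) = 0.
  have [//|nz] := eqVneq (g + (g \Po sg)) 0; exfalso.
  have nd : g - (g \Po sg) != 0 by rewrite -size_poly_gt0 (leq_trans _ szd).
  have : (size ((2%:R * e - 1)%:P * (8%:R *: ('X - e%:P)))%R <= 2)%N.
    rewrite mul_polyC; apply: leq_trans (size_scale_leq _ _) _.
    by rewrite size_scale // size_XsubC.
  rewrite -lin size_mul //; move: nz szd; rewrite -size_poly_gt0 /k.
  by move: (size (g + _)%R) (size (g - _)%R) m0 => u v; lia.
(* The product is now 0, so the constant factor of the linear right-hand side must vanish. *)
have e2 : 2%:R * e = 1.
  move: lin; rewrite gsg0 mulr0 => /esym/eqP; rewrite mulf_eq0 scaler_eq0.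
  by rewrite polyXsubC_eq0 polyC_eq0 !orbF subr_eq0 => /eqP.
pose a := a' / 4%:R.
have a0 : a != 0 by rewrite mulf_neq0.
have f1E : f1 = quad a c.
  rewrite fE /quad; congr (_ + _).
  have -> : centredX = 2%:R *: ('X - e%:P).
    by rewrite /centredX scalerBr -(mul_polyC _ e%:P) -polyCM e2.
  by rewrite exprZn scalerA /a -natrX divfK.
(* The inverse substitution x = (Z + 1) / 2 moves the axis to 0, where antisymmetry becomes
   oddness. *)
pose hf : {poly rat} := 2%:R^-1 *: ('X + 1).
have hfK : hf \Po centredX = 'X.
  rewrite /hf comp_polyZ comp_polyD comp_polyX comp_poly1.
  by rewrite /centredX subrK scalerA mulVf ?scale1r.
have [p pE] : exists p, g \Po hf = (p \Po 'X^2) * 'X.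
  apply: odd_poly_factor; rewrite -comp_polyA.
  have -> : hf \Po - 'X = sg \Po hf.
    rewrite /sg /hf e2 comp_polyB comp_polyC comp_polyX comp_polyZ.
    rewrite comp_polyD comp_polyX comp_poly1.
    apply: (scalerI n2); rewrite scalerBr !scalerA divff // !scale1r.
    rewrite -!mul_polyC !rmorph_nat; ring.
  rewrite comp_polyA; move/eqP: gsg0; rewrite addrC addr_eq0 => /eqP ->.
  by rewrite raddfN.
(* Z^2 = (f1 - c) / a turns a polynomial in Z^2 into one in [f1]. *)
pose q := p \Po (a^-1 *: ('X - c%:P)).
have qE : q \Po f1 = p \Po centredX ^+ 2.
  rewrite /q -comp_polyA comp_polyZ comp_polyB comp_polyX comp_polyC f1E.
  by rewrite /quad addrK scalerA mulVf // scale1r.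
have gE2 : g = centredX * (q \Po f1).
  rewrite qE -[LHS]comp_polyXr -hfK comp_polyA pE comp_polyM -comp_polyA.
  by rewrite comp_polyX comp_poly_sqr comp_polyX mulrC.
exists a, c, q; split => //; last by rewrite /mksol -f1E -gE2 -f2E.
have szf : (1 < size f1)%N by rewrite sz1.
(* Composition with the nonconstant [f1] is injective, so the identity may be checked after
   substituting [f1]. *)
apply/eqP; rewrite -subr_eq0 -(comp_poly_eq0 _ szf) comp_polyB subr_eq0.
rewrite comp_polyZ comp_polyM !comp_polyB comp_polyX comp_poly_sqr.
rewrite comp_poly1 !comp_polyC.
have -> : f1 - c%:P = a *: centredX ^+ 2 by rewrite f1E /quad addrK.
have -> : 8%:R * a / k`!%:R = a * (8%:R / k`!%:R) by ring.
rewrite -[X in _ == X]scalerA -(addKr (centredX ^+ 2) (_ *: (_ \Po _))) -gE gE2.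
by apply/eqP; rewrite -!mul_polyC; ring.
Qed.

(** * Backward differences and interpolation *)

Definition backward_diff (p : {poly rat}) : {poly rat} := p - (p \Po ('X - 1%:P)).

Lemma backward_diffE p x : (backward_diff p).[x] = p.[x] - p.[x - 1].
Proof. by rewrite /backward_diff hornerD hornerN horner_comp hornerXsubC. Qed.

Lemma size_backward_diff (p : {poly rat}) : (size (backward_diff p) <= (size p).-1)%N.
Proof.
have [-> |p0] := eqVneq p 0.
  by rewrite /backward_diff comp_poly0 subrr size_poly0.
have szX := size_XsubC (1 : rat).
have szp : size (p \Po ('X - 1%:P)) = size p by rewrite size_comp_poly2.
apply/leq_sizeP => j lej; rewrite /backward_diff coefB.
have [ltj|gej] := ltnP j (size p); last by rewrite !nth_default ?szp ?subrr.
have -> : j = (size p).-1 by apply/eqP; rewrite eqn_leq lej -ltnS -polySpred // ltj.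
have := @lead_coef_comp _ p ('X - 1%:P).
rewrite szX lead_coefXsubC expr1n mulr1 /lead_coef szp => -> //.
exact: subrr.
Qed.

Lemma iter_backward_diff_eq0 (p : {poly rat}) n :
  (size p <= n)%N -> iter n backward_diff p = 0.
Proof.
elim: n p => [|n IH] p; first by rewrite leqn0 size_poly_eq0 => /eqP.
move=> szp; rewrite iterSr IH // (leq_trans (size_backward_diff p)) //.
by case: (size p) szp.
Qed.

Lemma poly_eq_on_iota (p q : {poly rat}) n :
  (size p <= n)%N -> (size q <= n)%N ->
  (forall i, (i < n)%N -> p.[i%:R] = q.[i%:R]) -> p = q.
Proof.
move=> szp szq pq; apply/eqP; rewrite -subr_eq0; apply: contraT => nz.
have := @max_poly_roots _ (p - q) [seq i%:R | i <- iota 0 n] nz.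
rewrite size_map size_iota ltnNge.
have -> : (size (p - q)%R <= n)%N.
  by rewrite (leq_trans (size_polyD _ _)) // size_polyN geq_max szp.
apply.
  apply/allP => x /mapP[i]; rewrite mem_iota => /= lti ->.
  by rewrite /root hornerD hornerN pq // subrr.
by rewrite map_inj_uniq ?iota_uniq // => i j /eqP; rewrite eqr_nat => /eqP.
Qed.

(** * Searching sign patterns with difference tables *)

(** The search runs on binary integers so that it can be evaluated by [vm_compute]; this map carries
    its results to the rationals. *)
Definition rat_of_Z (z : Z) : rat := (int_of_Z z)%:~R.

Lemma rat_of_ZB x y : rat_of_Z (Z.sub x y) = rat_of_Z x - rat_of_Z y.
Proof. by rewrite /rat_of_Z -rmorphB; congr (_%:~R); lia. Qed.

Lemma rat_of_ZN x : rat_of_Z (Z.opp x) = - rat_of_Z x.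
Proof. by rewrite /rat_of_Z -rmorphN; congr (_%:~R); lia. Qed.

Lemma rat_of_Z_nat n : rat_of_Z (Z.of_nat n) = n%:R.
Proof. by rewrite /rat_of_Z pmulrn; congr (_%:~R); lia. Qed.

Lemma rat_of_Z_eq0 x : (rat_of_Z x == 0) = (x == Z0).
Proof. by rewrite /rat_of_Z intr_eq0 -(inj_eq (can_inj int_of_ZK)). Qed.

(* If [col] lists the backward differences of orders 0, 1, ... at [x - 1] and [v]
   is the value at [x], this lists the differences at [x]. *)
Fixpoint diffs (v : Z) (col : seq Z) : seq Z :=
  v :: (if col is d :: col' then diffs (Z.sub v d) col' else [::]).

Lemma mkseqS (T : Type) (f : nat -> T) n :
  mkseq f n.+1 = f 0%N :: mkseq (fun i => f i.+1) n.
Proof. by rewrite /mkseq /= -[1%N]/(1 + 0)%N iotaDl -map_comp. Qed.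

Lemma diffsE p x n v col : rat_of_Z v = p.[x] ->
  map rat_of_Z col = mkseq (fun j => (iter j backward_diff p).[x - 1]) n ->
  map rat_of_Z (diffs v col) = mkseq (fun j => (iter j backward_diff p).[x]) n.+1.
Proof.
elim: col n v p => [|d col IH] [|n] v p vE //; first by rewrite /mkseq /= vE.
rewrite 2!mkseqS => -[dE colE]; rewrite /= vE; congr (_ :: _).
have itE y r : mkseq (fun j => (iter j.+1 backward_diff p).[y]) r =
    mkseq (fun j => (iter j backward_diff (backward_diff p)).[y]) r.
  by apply: eq_map => j; rewrite iterSr.
rewrite itE; apply: IH; last by rewrite -itE.
by rewrite rat_of_ZB vE dE backward_diffE.
Qed.

(* All ways to choose signs in [ts] so that the result is a sequence of
   consecutive values of a polynomial of degree less than [n], given the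
   differences [col] at the preceding point. *)
Fixpoint sign_choices (n : nat) (ts col : seq Z) : seq (seq Z) :=
  if ts is t :: ts' then
    flatten [seq let col' := diffs v col in
                 if all (Z.eqb Z0) (drop n col')
                 then map (cons v) (sign_choices n ts' col') else [::]
            | v <- if Z.eqb t Z0 then [:: Z0] else [:: t; Z.opp t]]
  else [:: [::]].

(** The true values of [p] are never pruned, because its differences of order [n] and above
    vanish. *)
Lemma sign_choicesP n (p : {poly rat}) x j ts col :
  (size p <= n)%N ->
  map rat_of_Z col = mkseq (fun i => (iter i backward_diff p).[x - 1]) j ->
  (forall i, (i < size ts)%N ->
     p.[x + i%:R] ^+ 2 = rat_of_Z (nth Z0 ts i) ^+ 2) ->
  exists2 l, l \in sign_choices n ts col &
    map rat_of_Z l = mkseq (fun i => p.[x + i%:R]) (size ts).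
Proof.
move=> szp; elim: ts x j col => [|t ts IH] x j col colE tsE; first by exists [::].
have [v v_in vE] : exists2 v,
    v \in (if Z.eqb t Z0 then [:: Z0] else [:: t; Z.opp t]) & rat_of_Z v = p.[x].
  have := tsE 0%N isT; rewrite addr0 /= => /eqP; rewrite eqf_sqr.
  (* For a zero entry both signs coincide and the search has a single branch. *)
  case: Z.eqb_spec => [->|_].
    rewrite -[rat_of_Z Z0]/0 oppr0 orbb => /eqP ->; exists Z0; first exact: mem_head.
    by [].
  case/orP => /eqP ->; [exists t|exists (Z.opp t)] => //; rewrite ?inE ?eqxx ?orbT //.
  exact: rat_of_ZN.
have col'E := diffsE vE colE.
have [l l_in lE] : exists2 l, l \in sign_choices n ts (diffs v col) &
    map rat_of_Z l = mkseq (fun i => p.[x + 1 + i%:R]) (size ts).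
  apply: (IH _ j.+1); first by rewrite addrK.
  by move=> i lti; rewrite -addrA nat1r; apply: (tsE i.+1).
exists (v :: l); last first.
  rewrite [size _]/= mkseqS /= vE lE addr0; congr (_ :: _).
  by apply: eq_map => i; rewrite -addrA nat1r.
apply/flatten_mapP; exists v => //=.
have -> : all (Z.eqb Z0) (drop n (diffs v col)).
  apply/(all_nthP Z0) => i; rewrite size_drop nth_drop => lti.
  rewrite Z.eqb_sym; apply/Z.eqb_eq/eqP; rewrite -rat_of_Z_eq0.
  have sz : size (diffs v col) = j.+1.
    by rewrite -(size_map rat_of_Z) col'E size_mkseq.
  rewrite -(nth_map _ 0) ?col'E ?nth_mkseq; try (rewrite ?sz; lia).
  by rewrite iter_backward_diff_eq0 ?horner0 // (leq_trans szp) ?leq_addr.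
by rewrite map_f.
Qed.

(** * Ideal splits and the solutions they give *)

Definition offsets k c : seq Z := [seq Z.sub (Z.of_nat t) (Z.of_nat c) | t <- iota 0 k].

(* A quadruple [(c, A, B, C)]: the integers [0 .. k - 1] other than [c] are split
   into [A] and [B] so that the monic polynomials with these roots differ by [C]. *)
Definition root_split := (nat * seq nat * seq nat * rat)%type.

Definition centre (d : root_split) := d.1.1.1.

Definition roots_poly (A : seq nat) : {poly rat} := \prod_(a <- A) ('X - a%:R%:P).

Definition ideal_split k (d : root_split) : Prop :=
  let: (c, A, B, C) := d in
  [/\ perm_eq (c :: A ++ B) (iota 0 k), C != 0
    & roots_poly B - roots_poly A = C%:P].

(** The [q] with value 1 on [A] and -1 on [B]: at a root of the second polynomial the first one
    equals -C. *)
Definition split_poly (d : root_split) : {poly rat} :=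
  let: (c, A, B, C) := d in 1 + (2%:R / C) *: roots_poly A.

(** Forced by the leading coefficients in [pell_eq]: 8a / k! = (2 / C)^2. *)
Definition split_scale k (d : root_split) : rat := k`!%:R / 8%:R * (2%:R / d.2) ^+ 2.

Definition split_sol k (d : root_split) :=
  mksol (split_scale k d) (centre d)%:R (split_poly d).

Definition split_values k (d : root_split) : seq Z :=
  [seq if t \in d.1.1.2 then Z.sub (Z.of_nat t) (Z.of_nat (centre d))
       else Z.sub (Z.of_nat (centre d)) (Z.of_nat t) | t <- iota 0 k].

Lemma split_scale_neq0 k d : ideal_split k d -> split_scale k d != 0.
Proof.
case: d => [[[c A] B] C] [/= _ C0 _]; rewrite /split_scale /=.
rewrite !mulf_neq0 ?expf_neq0 ?mulf_neq0 ?invr_eq0 // pnatr_eq0.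
by rewrite -lt0n fact_gt0.
Qed.

Lemma split_scaleE k d : 8%:R * split_scale k d / k`!%:R = (2%:R / d.2) ^+ 2.
Proof.
have k0 : k`!%:R != 0 :> rat by rewrite pnatr_eq0 -lt0n fact_gt0.
rewrite /split_scale; move: (_ ^+ 2) k0 => w; move: (k`!%:R : rat) => u u0.
by field.
Qed.

(** With u = 2 / C, q - 1 and q + 1 are u times the polynomials of [A] and [B], so q^2 - 1 has all
    integers but the centre as roots. *)
Lemma split_pell k d : ideal_split k d ->
  pell_eq k (split_scale k d) (centre d)%:R (split_poly d).
Proof.
move=> Sd; rewrite /pell_eq split_scaleE; move: d Sd.
case=> [[[c A] B] C] [/= perm_k C0 AB]; rewrite /centre /=.
have -> : fallp k = ('X - c%:R%:P) * (roots_poly A * roots_poly B).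
  rewrite /fallp -(big_mkord xpredT (fun i => 'X - i%:R%:P)) /index_iota subn0.
  by rewrite -(perm_big _ perm_k) big_cons big_cat.
have -> : roots_poly B = roots_poly A + C%:P by rewrite -AB addrC subrK.
have CC : (2%:R / C)%:P * C%:P = 2%:R :> {poly rat}.
  by rewrite -polyCM divfK // rmorph_nat.
rewrite -!mul_polyC rmorphXn /=; move: CC; move: (_ / _)%:P => u CC.
transitivity (('X - c%:R%:P) * (u * roots_poly A * (u * roots_poly A + u * C%:P))).
  by rewrite CC; ring.
by ring.
Qed.

Lemma split_valuesP k d i : ideal_split k d -> (i < k)%N ->
  rat_of_Z (nth Z0 (split_values k d) i) =
  (('X - (centre d)%:R%:P) * split_poly d).[i%:R].
Proof.
case: d => [[[c A] B] C] [/= perm_k C0 AB] lti.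
rewrite (nth_map 0%N) ?size_iota // nth_iota // add0n /centre /=.
rewrite hornerM hornerXsubC hornerD hornerZ hornerC.
have rootE S : ((roots_poly S).[i%:R] == 0) = (i \in S).
  rewrite /roots_poly horner_prod prodf_seq_eq0; apply/hasP/idP.
    by case=> a aS /=; rewrite hornerXsubC subr_eq0 eqr_nat => /eqP ->.
  by move=> iS; exists i => //=; rewrite hornerXsubC subrr.
have [iA|niA] := boolP (i \in A).
  move: iA; rewrite -rootE => /eqP ->.
  by rewrite mulr0 addr0 mulr1 rat_of_ZB !rat_of_Z_nat.
have : i \in c :: A ++ B by rewrite (perm_mem perm_k) mem_iota.
rewrite inE mem_cat (negPf niA) /= rat_of_ZB !rat_of_Z_nat.
case/orP => [/eqP ->|]; first by rewrite subrr mul0r.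
rewrite -rootE => /eqP iB.
have -> : (roots_poly A).[i%:R] = - C.
  have := congr1 (fun p => p.[i%:R]) AB.
  by rewrite /= hornerD hornerN iB hornerC sub0r => <-; rewrite opprK.
by rewrite mulrN divfK //; ring.
Qed.

(** * Completeness of a list of splits *)

(* The offsets themselves, up to sign, are the spurious choice [q = 1] or [q = -1]. *)
Definition complete m (D : seq root_split) : bool :=
  let k := m.*2.+1 in
  all (fun c => all (fun l =>
         [|| l == offsets k c, l == map Z.opp (offsets k c)
           | has (fun d => (centre d == c) &&
                    (l \in [:: split_values k d; map Z.opp (split_values k d)])) D])
       (sign_choices m.+2 (offsets k c) [::])) (iota 0 k).

Lemma pell_values m (a c : rat) q : (0 < m)%N -> a != 0 -> pell_eq m.*2.+1 a c q ->
  exists2 i, (i < m.*2.+1)%N & c = i%:R /\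
  exists2 l, l \in sign_choices m.+2 (offsets m.*2.+1 i) [::] &
    size l = m.*2.+1 /\
    forall t, (t < m.*2.+1)%N -> rat_of_Z (nth Z0 l t) = (('X - c%:P) * q).[t%:R].
Proof.
move=> m0 a0 E; have l0 := pell_scal_neq0 m.*2.+1 a0.
have szq := pell_size m0 l0 E; set k := m.*2.+1 in l0 E *.
have /root_fallpP[i lti cE] : root (fallp k) c.
  have := congr1 (fun p => p.[c]) E.
  rewrite /= hornerM hornerXsubC subrr mul0r hornerZ => /esym/eqP.
  by rewrite mulf_eq0 (negPf l0).
exists i => //; split=> //; set p := _ * q.
have szp : (size p <= m.+2)%N.
  rewrite /p size_mul ?polyXsubC_eq0 ?size_XsubC ?szq //.
  by rewrite -size_poly_eq0 szq.
have sz_off : size (offsets k i) = k by rewrite size_map size_iota.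
have [t ltt|l l_in lE] :=
    @sign_choicesP m.+2 p 0 0 (offsets k i) [::] szp (erefl _).
  rewrite sz_off in ltt.
  rewrite (nth_map 0%N) ?size_iota // nth_iota // !add0n.
  rewrite rat_of_ZB !rat_of_Z_nat -cE /p hornerM hornerXsubC.
  have Pt : (fallp k).[t%:R] = 0 by apply/eqP/root_fallpP; exists t.
  have := congr1 (fun p => p.[t%:R]) E.
  rewrite /= hornerM hornerXsubC hornerZ Pt mulr0 hornerD hornerN hornerC.
  rewrite horner_exp => E'; apply/eqP; rewrite -subr_eq0; apply/eqP.
  (* The extra factor t - c covers t = c together with the other points. *)
  transitivity ((t%:R - c) * ((t%:R - c) * (q.[t%:R] ^+ 2 - 1))).
    by rewrite !add0r; ring.
  by rewrite E' mulr0.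
exists l => //.
have szl : size l = k by rewrite -(size_map rat_of_Z) lE size_mkseq sz_off.
split=> // t ltt; rewrite -(nth_map _ 0) ?szl // lE nth_mkseq ?sz_off //.
by rewrite add0r.
Qed.

(** The values at 0, ..., k - 1 determine [q], since (y - c) q(y) has degree m + 1 < k. Constant [q]
    is excluded by its degree, and [a] is recovered from [q]. *)
Lemma complete_solutions m D : (0 < m)%N ->
  (forall d, d \in D -> ideal_split m.*2.+1 d) -> complete m D ->
  forall s, is_solution m.*2.+1 s ->
  exists2 d, d \in D & same_solution (split_sol m.*2.+1 d) s.
Proof.
move=> m0 DS complD s /(solution_mksol m0)[a [c [q [a0 E ->]]]].
have szq := pell_size m0 (pell_scal_neq0 _ a0) E.
have [i lti [cE [l l_in [szl lE]]]] := pell_values m0 a0 E.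
set k := m.*2.+1 in DS E lti l_in szl lE *.
have i_in : i \in iota 0 k by rewrite mem_iota.
have Xc : 'X - c%:P != 0 by rewrite polyXsubC_eq0.
have determined (q' : {poly rat}) : (size q' <= m.+1)%N ->
    (forall t, (t < k)%N -> rat_of_Z (nth Z0 l t) = (('X - c%:P) * q').[t%:R]) ->
    q = q'.
  move=> szq' lE'; apply: (mulfI Xc); apply: (@poly_eq_on_iota _ _ k) => [||t ltt].
  - by apply: leq_trans (size_polyMleq _ _) _; rewrite size_XsubC szq /k; lia.
  - apply: leq_trans (size_polyMleq _ _) _; rewrite size_XsubC.
    by move: (size q') szq' m0; rewrite /k; lia.
  - by rewrite -lE ?lE'.
have oppE (l' : seq Z) t : rat_of_Z (nth Z0 (map Z.opp l') t) =
    - rat_of_Z (nth Z0 l' t).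
  have [ltt|get] := ltnP t (size l'); first by rewrite (nth_map Z0) // rat_of_ZN.
  by rewrite !nth_default ?size_map // oppr0.
have not_const (e : rat) : q != e%:P.
  by apply/eqP => qe; have := size_polyC_leq1 e; rewrite -qe szq leqNgt ltnS m0.
have offE t : (t < k)%N ->
    rat_of_Z (nth Z0 (offsets k i) t) = (('X - c%:P) * 1%:P).[t%:R].
  move=> ltt; rewrite (nth_map 0%N) ?size_iota // nth_iota // add0n.
  by rewrite mulr1 hornerXsubC rat_of_ZB !rat_of_Z_nat cE.
have sz1 (e : rat) : (size e%:P <= m.+1)%N by rewrite (leq_trans (size_polyC_leq1 _)).
have /or3P[/eqP lo|/eqP lo|/hasP[d dD /andP[/eqP di lv]]] :=
    allP (allP complD _ i_in) _ l_in.
- suff /eqP : q = 1%:P by rewrite (negPf (not_const _)).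
  by apply: determined => [|t ltt]; rewrite ?lo ?offE.
- suff /eqP : q = (-1)%:P by rewrite (negPf (not_const _)).
  apply: determined => [|t ltt]; first exact: sz1.
  by rewrite lo oppE offE // polyCN mulrN hornerN.
- exists d => //; have Sd := DS _ dD; have pellD := split_pell Sd.
  have aD := split_scale_neq0 Sd.
  have szD := pell_size m0 (pell_scal_neq0 _ aD) pellD.
  rewrite di -cE in pellD.
  have valD t : (t < k)%N -> rat_of_Z (nth Z0 (split_values k d) t) =
      (('X - c%:P) * split_poly d).[t%:R].
    by move=> ltt; rewrite split_valuesP // di cE.
  have qd : q = split_poly d \/ q = - split_poly d.
    move: lv; rewrite !inE => /orP[] /eqP lv; [left|right];
      apply: determined; rewrite ?size_polyN ?szD //.
      by move=> t ltt; rewrite lv valD.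
    by move=> t ltt; rewrite lv oppE valD // mulrN hornerN.
  have aE : a = split_scale k d.
    have q2 : q ^+ 2 = split_poly d ^+ 2 by case: qd => ->; rewrite ?sqrrN.
    move: E; rewrite /pell_eq q2 pellD => /eqP; rewrite -subr_eq0 -scalerBl.
    rewrite scaler_eq0 (negPf (fallp_neq0 _)) orbF subr_eq0.
    have kf : k`!%:R != 0 :> rat by rewrite pnatr_eq0 -lt0n fact_gt0.
    by move/eqP/(divIf kf)/(mulfI (isT : 8%:R != 0 :> rat)).
  rewrite /same_solution /split_sol reflect_mksol di -cE aE.
  by case: qd => ->; [left|right].
Qed.

Lemma has_exactly_splits m D : (0 < m)%N -> uniq (map centre D) ->
  (forall d, d \in D -> ideal_split m.*2.+1 d) -> complete m D ->
  has_exactly_solutions m.*2.+1 (size D).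
Proof.
move=> m0 uD DS complD; exists (map (split_sol m.*2.+1) D); split.
- by rewrite size_map.
- move=> _ /mapP[d dD ->]; apply: mksol_is_solution => //.
    exact: split_scale_neq0 (DS _ dD).
  exact: split_pell (DS _ dD).
(* The centre is the value of f_1 on the axis x = 1/2, which reflection preserves; distinct centres
   thus give inequivalent solutions. *)
- have ev a c q : (mksol a c q).1.[2%:R^-1] = c.
    rewrite /mksol /quad /centredX /= hornerD hornerZ hornerC horner_exp hornerD hornerN.
    by rewrite hornerZ hornerX hornerC divff // subrr expr0n mulr0 add0r.
  move=> i j; rewrite size_map => lti ltj; pose d0 : root_split := (0%N, [::], [::], 0).
  rewrite !(nth_map d0) // => same; apply/eqP.
  rewrite -(nth_uniq 0%N _ _ uD) ?size_map // !(nth_map d0) // -(eqr_nat rat).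
  by apply/eqP; case: same; rewrite /split_sol ?reflect_mksol;
    move/(congr1 (fun s => s.1.[2%:R^-1])); rewrite !ev.
- move=> s /(complete_solutions m0 DS complD)[d dD same].
  by exists (split_sol m.*2.+1 d); rewrite ?map_f.
Qed.

Lemma no_solutions m s : (0 < m)%N -> complete m [::] -> ~ is_solution m.*2.+1 s.
Proof. by move=> m0 complD /(complete_solutions m0 _ complD)[]. Qed.

(** * The explicit splits and the computations for each k *)

(** Exchanging the two sets and negating the constant turns [q] into [- q], the reflected solution,
    so each split is listed in one orientation only. *)
Definition splits3 : seq root_split :=
  [:: (0, [:: 1], [:: 2], -1%R); (1, [:: 0], [:: 2], -2%:R);
      (2, [:: 0], [:: 1], -1%R)]%N.

Definition splits5 : seq root_split :=
  [:: (0, [:: 1; 4], [:: 2; 3], 2%:R); (2, [:: 0; 4], [:: 1; 3], 3%:R);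
      (4, [:: 0; 3], [:: 1; 2], 2%:R)]%N.

Definition splits7 : seq root_split := [:: (3, [:: 0; 4; 5], [:: 1; 2; 6], -12%:R)]%N.

Lemma ideal_splits3 d : d \in splits3 -> ideal_split 3 d.
Proof.
rewrite !inE => /or3P[] /eqP ->; split=> //;
  rewrite /roots_poly !big_cons !big_nil ?rmorphN !rmorph_nat /=; ring.
Qed.

Lemma ideal_splits5 d : d \in splits5 -> ideal_split 5 d.
Proof.
rewrite !inE => /or3P[] /eqP ->; split=> //;
  rewrite /roots_poly !big_cons !big_nil ?rmorphN !rmorph_nat /=; ring.
Qed.

Lemma ideal_splits7 d : d \in splits7 -> ideal_split 7 d.
Proof.
rewrite !inE => /eqP ->; split=> //;
  rewrite /roots_poly !big_cons !big_nil ?rmorphN !rmorph_nat /=; ring.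
Qed.

Lemma complete_splits3 : complete 1 splits3. Proof. by vm_compute. Qed.
Lemma complete_splits5 : complete 2 splits5. Proof. by vm_compute. Qed.
Lemma complete_splits7 : complete 3 splits7. Proof. by vm_compute. Qed.

Lemma complete_nil m : (3 < m < 10)%N -> complete m [::].
Proof.
have : all (fun m => complete m [::]) (iota 4 6) by vm_compute.
by move/allP => H m_in; apply: H; rewrite mem_iota.
Qed.

Local Close Scope ring_scope.

Theorem theorem5 (k : nat) (k_odd : odd k) :
  [/\ k = 3 \/ k = 5 -> has_exactly_solutions k 3,
      k = 7 -> has_exactly_solutions k 1
    & k \in [:: 9; 11; 13; 15; 17; 19] ->
      forall s : {poly rat} * {poly rat}, ~ is_solution k s].
Proof.
split.
- case=> ->.
    exact: (@has_exactly_splits 1 splits3 isT isT ideal_splits3 complete_splits3).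
  exact: (@has_exactly_splits 2 splits5 isT isT ideal_splits5 complete_splits5).
- move=> ->; exact: (@has_exactly_splits 3 splits7 isT isT ideal_splits7 complete_splits7).
- move=> k_in s.
  have [m m_in ->] : exists2 m, (3 < m < 10)%N & k = m.*2.+1.
    move: k_in; rewrite !inE => k_in; exists k./2; first lia.
    by rewrite -{1}[k]odd_double_half k_odd.
  apply: no_solutions (complete_nil m_in); lia.
Qed.
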